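(* Let $0<q<1$ and $0\le p<1$. Let $\tilde P_n(x)=\sum_{k=0}^n\tilde b_{k,n}x^k$ ($n\ge0$) be the orthonormal polynomials (with positive leading coefficients) associated with the moment sequence $(\tilde s_n)$, and let $P_n(x;p,q)=\sum_{k=0}^n b_{k,n}x^k$ with $b_{k,n}$ as in the context. Then for $0\le k\le n$, \[ \tilde b_{k,n}=\tilde C_n (-1)^k\begin{bmatrix}n\\k\end{bmatrix}_q \frac{q^{k^2+k/2}}{(p;q)_k} \left[1-\frac{1-q^k}{1-pq^k}\frac{(q^{n+1};q)_\infty}{(pq^{n+1};q)_\infty}\right], \] where \[ \tilde C_n=(-1)^nq^{n/2+1/4}\sqrt{\frac{(p;q)_n}{(q;q)_n}} \left[\left(1-\frac{(q^n;q)_\infty}{(pq^n;q)_\infty}\right)\left(1-\frac{(q^{n+1};q)_\infty}{(pq^{n+1};q)_\infty}\right)\right]^{-1/2} =(-1)^nq^{n/2+1/4}\sqrt{\frac{(p;q)_{n+1}}{(q;q)_n}}\, \frac{(pq^{n+1};q)_\infty}{\sqrt{\Delta_n\Delta_{n+1}}}, \] i.e. \[ \tilde b_{k,n}=b_{k,n} \left[(pq^{n+1};q)_\infty-\frac{1-q^k}{1-pq^k}(q^{n+1};q)_\infty\right] \sqrt{\frac{1-pq^n}{\Delta_n\Delta_{n+1}}}. \] Moreover, for all $n\ge0$, \[ \tilde D_n=\frac{\Delta_{n+1}}{(pq^{n+1};q)_\infty}D_n, \] where $D_n=\det(s_{i+j})_{0\le i,j\le n}$ and $\tilde D_n=\det(\tilde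 s_{i+j})_{0\le i,j\le n}$.
   Context: For $a\in\mathbb C$ and $n\in\{0,1,\dots\}\cup\{\infty\}$, $(a;q)_n=\prod_{k=1}^n(1-aq^{k-1})$; $\begin{bmatrix}n\\k\end{bmatrix}_q=\frac{(q;q)_n}{(q;q)_k(q;q)_{n-k}}$. Set $\Delta_n=(pq^n;q)_\infty-(q^n;q)_\infty$ for $n\ge0$. The generalized Stieltjes–Wigert moments are $s_n=(p;q)_nq^{-(n+1)^2/2}$, $n\ge0$; the modified moments are $\tilde s_0=q^{-1/2}\bigl[1-(q;q)_\infty/(pq;q)_\infty\bigr]$ and $\tilde s_n=s_n$ for $n\ge1$ (these are the moments of the measure obtained from the N-extremal solution of the $(s_n)$ moment problem by removing its mass $(q;q)_\infty/(\sqrt q\,(pq;q)_\infty)$ at $0$). The orthonormal polynomials for a positive definite moment sequence $(u_n)$ are $P_n(x)=\frac{1}{\sqrt{E_{n-1}E_n}}\det\begin{pmatrix}u_0&\cdots&u_n\\ \vdots&&\vdots\\ u_{n-1}&\cdots&u_{2n-1}\\ 1&\cdots&x^n\end{pmatrix}$ with $E_n=\det(u_{i+j})_{0\le i,j\le n}$, $E_{-1}=1$. The orthonormal polynomials for $(s_n)$ are $P_n(x;p,q)=\sum_{k=0}^n b_{k,n}x^k$ with $b_{k,n}=(-1)^nq^{n/2+1/4}\sqrt{\frac{(p;q)_n}{(q;q)_n}}(-1)^k\begin{bmatrix}n\\k\end{bmatrix}_q\frac{q^{k^2+k/2}}{(p;q)_k}$. *)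

(* Defs.v *)
From HB Require Import structures.
From mathcomp Require Import all_boot all_order all_algebra.
From mathcomp Require Import all_classical all_reals all_analysis.
Set Implicit Arguments. Unset Strict Implicit. Unset Printing Implicit Defensive.
Import Order.TTheory GRing.Theory Num.Theory.
Import numFieldNormedType.Exports.
Local Open Scope ring_scope.

Definition qpoch {R : realType} (a q : R) (n : nat) : R :=
  \prod_(k < n) (1 - a * q ^+ k).

Definition qpochInf {R : realType} (a q : R) : R := limn (qpoch a q).

Definition qbinom {R : realType} (q : R) (n k : nat) : R :=
  qpoch q q n / (qpoch q q k * qpoch q q (n - k)).

Definition Delta {R : realType} (p q : R) (n : nat) : R :=
  qpochInf (p * q ^+ n) q - qpochInf (q ^+ n) q.

Definition sw_mom {R : realType} (p q : R) (n : nat) : R :=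
  qpoch p q n * powR q (- ((n.+1)%:R ^+ 2) / 2).

Definition sw_mom_tilde {R : realType} (p q : R) (n : nat) : R :=
  if n is 0 then powR q (- (1 / 2)) * (1 - qpochInf q q / qpochInf (p * q) q)
  else sw_mom p q n.

Definition hankel {R : realType} (u : nat -> R) (n : nat) : R :=
  \det (\matrix_(i < n.+1, j < n.+1) u (i + j)%N).

Definition hankel_prev {R : realType} (u : nat -> R) (n : nat) : R :=
  if n is m.+1 then hankel u m else 1.

(* orthonormal polynomial P_n for the moment sequence u, via the determinant
   formula: the last row of the matrix is (1, x, ..., x^n) *)
Definition orthonormal_poly {R : realType} (u : nat -> R) (n : nat) : {poly R} :=
  (Num.sqrt (hankel_prev u n * hankel u n))^-1 *:
    \det (\matrix_(i < n.+1, j < n.+1)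
            (if (i < n)%N then (u (i + j)%N)%:P else 'X^j)).

Definition sw_coef {R : realType} (p q : R) (k n : nat) : R :=
  (-1) ^+ n * powR q (n%:R / 2 + 1 / 4) * Num.sqrt (qpoch p q n / qpoch q q n)
  * (-1) ^+ k * qbinom q n k * powR q (k%:R ^+ 2 + k%:R / 2) / qpoch p q k.

(* Main.v *)
(* If a vector v solves the Hankel system \sum_k u_(i+k) v_k = h * [i = n]
   for i <= n, then by Cramer's rule v is proportional to the last row of
   cofactors, so the n-th orthonormal polynomial has coefficients
   sg(h) v_k / sqrt(h v_n), and E_n v_n = h E_(n-1).  It remains to check that
   the asserted coefficients solve the system for the modified moments.  After
   cancelling powers of q, each equation becomes a sum
   qdiff n f = \sum_k (-1)^k [n, k]_q q^(k choose 2) f(k).  For i >= 1,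
   f(k) is a polynomial of degree i in q^-k, and
   qdiff n (z^k) = (z; q)_n vanishes at z = q^-m for m < n.  For i = 0 the
   factor (1 - q^k) / (1 - p q^k) contributes (q; q)_n / (pq; q)_n through the
   partial fraction sum, which is exactly compensated by the mass removed
   at 0. *)
Require Import Defs.
From HB Require Import structures.
From mathcomp Require Import all_boot all_order all_algebra.
From mathcomp Require Import all_classical all_reals all_analysis.
From mathcomp Require Import ring lra zify.
Import Order.TTheory GRing.Theory Num.Theory.
Import numFieldNormedType.Exports.
Set Implicit Arguments. Unset Strict Implicit. Unset Printing Implicit Defensive.
Local Open Scope ring_scope.

(** * Hankel systems, cofactors and orthonormal polynomials *)

Section HankelSystem.
Variable R : realType.
Implicit Types (u v : nat -> R) (h : R) (n k : nat).

Definition hankel_mx u n : 'M[R]_n.+1 := \matrix_(i, j) u (i + j)%N.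

Lemma cofactor_hankel_max u n :
  cofactor (hankel_mx u n) ord_max ord_max = hankel_prev u n.
Proof.
rewrite /cofactor addnn -signr_odd odd_double expr0 mul1r.
case: n => [|n]; first by rewrite det_mx00.
by congr (\det _); apply/matrixP => i j; rewrite !mxE !lift_max.
Qed.

(** Laplace expansion along the row of monomials: its cofactors involve only constant entries, so
    each ['X^j] contributes to one coefficient. *)
Lemma coef_last_row_det u n (k : 'I_n.+1) :
  (\det (\matrix_(i < n.+1, j < n.+1)
     (if (i < n)%N then (u (i + j)%N)%:P else 'X^j)))`_k
  = cofactor (hankel_mx u n) ord_max k.
Proof.
set M := \matrix_(_, _) _.
have E j : cofactor M ord_max j = (cofactor (hankel_mx u n) ord_max j)%:P.
  rewrite /cofactor rmorphM /= rmorphXn rmorphN1 -det_map_mx.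
  congr (_ * \det _); apply/matrixP => i l.
  by rewrite !mxE lift_max ltn_ord.
rewrite (expand_det_row _ ord_max) coef_sum (bigD1 k) //= big1 ?addr0.
  by rewrite mxE ltnn E coefXnM ltnn subnn coefC.
move=> j jk; rewrite mxE ltnn E coefXnM coefC; case: ltnP => // jk'.
by rewrite subn_eq0 leqNgt ltn_neqAle jk' andbT jk.
Qed.

Variables (u v : nat -> R) (n : nat) (h : R).
Hypothesis system : forall i, (i <= n)%N ->
  \sum_(j < n.+1) u (i + j)%N * v j = if i == n then h else 0.

(** Division-free Cramer's rule: multiply the system by the adjugate, whose last column is the last
    row of cofactors. *)
Lemma cofactor_hankel_system (k : 'I_n.+1) :
  h * cofactor (hankel_mx u n) ord_max k = hankel u n * v k.
Proof.
pose V : 'cV[R]_n.+1 := \col_j v j.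
have HV : hankel_mx u n *m V = h *: delta_mx ord_max 0.
  apply/matrixP => i j; rewrite !mxE ord1 eqxx andbT.
  transitivity (\sum_(l < n.+1) u (i + l)%N * v l).
    by apply: eq_bigr => l _; rewrite !mxE.
  rewrite system -1?ltnS ?ltn_ord // -val_eqE /=.
  by case: ifP; rewrite ?mulr1 ?mulr0.
have := congr1 (mulmx (\adj (hankel_mx u n))) HV.
rewrite mulmxA mul_adj_mx -scalemxAr mul_scalar_mx.
move/matrixP/(_ k 0); rewrite !mxE => ->; congr (_ * _).
rewrite (bigD1 ord_max) //= big1 ?addr0; first by rewrite !mxE !eqxx mulr1.
by move=> i /negPf ni; rewrite !mxE ni mulr0.
Qed.

Lemma hankel_system_step : hankel u n * v n = h * hankel_prev u n.
Proof. by rewrite -cofactor_hankel_max (cofactor_hankel_system ord_max). Qed.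

(** Write D for [hankel_prev u n]. The unnormalised coefficient is D v_k / v_n, and the normalising
    root is D sqrt(h v_n) / |v_n|. The quotient |v_n| / v_n is the sign of h, because h v_n > 0. *)
Lemma coef_orthonormal_poly_system (k : 'I_n.+1) :
  0 < h * v n -> 0 < hankel_prev u n ->
  (orthonormal_poly u n)`_k = Num.sg h * v k / Num.sqrt (h * v n).
Proof.
move=> hv0 Dp.
have h0 : h != 0 by apply: contraTneq hv0 => ->; rewrite mul0r ltxx.
have v0 : v n != 0 by apply: contraTneq hv0 => ->; rewrite mulr0 ltxx.
rewrite /orthonormal_poly coefZ coef_last_row_det.
have -> : cofactor (hankel_mx u n) ord_max k = hankel u n * v k / h.
  by rewrite -cofactor_hankel_system; field.
(* This shape makes the product under the root a perfect square times h v_n. *)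
have -> : hankel u n = hankel_prev u n * (h * v n) / v n ^+ 2.
  by apply: (mulIf v0); rewrite hankel_system_step; field.
have -> : hankel_prev u n * (hankel_prev u n * (h * v n) / v n ^+ 2) =
  (hankel_prev u n / v n) ^+ 2 * (h * v n) by field.
rewrite sqrtrM ?sqr_ge0 // sqrtr_sqr normrM normfV (gtr0_norm Dp).
set s := Num.sqrt _.
have s0 : s != 0 by rewrite gt_eqF // sqrtr_gt0.
have Nv : `|v n| = Num.sg h * v n.
  move: hv0; case: (ltgtP 0 h) h0 => // hh _ hv0.
    by rewrite gtr0_sg // mul1r gtr0_norm // -(pmulr_rgt0 _ hh).
  by rewrite ltr0_sg // mulN1r ltr0_norm // -(nmulr_rgt0 _ hh).
rewrite Nv.
have sg0 : Num.sg h != 0 by rewrite sgr_eq0.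
have sg2 : Num.sg h * Num.sg h = 1 by rewrite -expr2 sqr_sg h0.
have -> : Num.sg h = (Num.sg h)^-1 by apply: (mulfI sg0); rewrite divff.
have D0 : hankel_prev u n != 0 by rewrite gt_eqF.
by field; rewrite s0 h0 v0 sg0 D0.
Qed.

End HankelSystem.

(** * Alternating q-binomial sums *)

Section QSums.
Variables (R : realType) (q : R).
Hypotheses (q0 : 0 < q) (q1 : q < 1).
Implicit Types (a z : R) (f : nat -> R) (n k : nat).

Lemma qpoch_recr a n : qpoch a q n.+1 = qpoch a q n * (1 - a * q ^+ n).
Proof. by rewrite /qpoch big_ord_recr. Qed.

Lemma qpoch_recl a n : qpoch a q n.+1 = (1 - a) * qpoch (a * q) q n.
Proof.
rewrite /qpoch big_ord_recl expr0 mulr1; congr (_ * _).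
by apply: eq_bigr => i _; rewrite exprS mulrA.
Qed.

Lemma mulXn_lt1 a n : 0 <= a -> a < 1 -> a * q ^+ n < 1.
Proof.
move=> a0 a1; apply: le_lt_trans a1.
by rewrite ler_piMr // exprn_ile1 // ltW.
Qed.

Lemma qpoch_gt0 a n : 0 <= a -> a < 1 -> 0 < qpoch a q n.
Proof.
by move=> a0 a1; apply: prodr_gt0 => k _; rewrite subr_gt0 mulXn_lt1.
Qed.

(* Unlike qbinom, which is nonzero for n < k because n - k truncates to 0. *)
Definition qbin n k : R := if (k <= n)%N then qbinom q n k else 0.

Lemma qbin_pascal n k :
  qbin n.+1 k.+1 = qbin n k.+1 + q ^+ (n - k) * qbin n k.
Proof.
have P m : qpoch q q m != 0 by rewrite gt_eqF // qpoch_gt0 // ltW.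
rewrite /qbin ltnS; case: (ltngtP k n) => kn; last 1 first.
- by rewrite kn /qbinom !subnn expr0 /qpoch !big_ord0; field; rewrite !P.
- rewrite /qbinom subSS.
  have -> : (n - k = (n - k.+1).+1)%N by lia.
  rewrite !qpoch_recr.
  have E : q ^+ n = q ^+ k * q ^+ (n - k.+1) * q.
    by rewrite -exprD -exprSr; congr (_ ^+ _); lia.
  have N m : 1 - q * q ^+ m != 0.
    by rewrite gt_eqF // subr_gt0 mulXn_lt1 // ltW.
  by rewrite E exprS; field; rewrite !P !N.
- by rewrite mulr0 addr0.
Qed.

Lemma qbin0 n : qbin n 0 = 1.
Proof.
rewrite /qbin /qbinom subn0 /qpoch big_ord0 mul1r divff // gt_eqF //.
by apply: qpoch_gt0; rewrite // ltW.
Qed.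

(** By [qdiffS] this is the product over j < n of the operators 1 - q^j E, with E the shift
    [f \o succn], applied to f and evaluated at 0. *)
Definition qdiff n f : R :=
  \sum_(k < n.+1) (-1) ^+ k * qbin n k * q ^+ 'C(k, 2) * f k.

Lemma qdiffS n f : qdiff n.+1 f = qdiff n f - q ^+ n * qdiff n (f \o succn).
Proof.
rewrite /qdiff big_ord_recl [X in _ = X - _]big_ord_recl !qbin0 -addrA.
congr (_ + _).
(* The sum may be extended to the index n + 1, where [qbin] vanishes; Pascal's rule then applies
   term by term. *)
have -> : \sum_(i < n) (-1) ^+ lift ord0 i * qbin n (lift ord0 i) *
     q ^+ 'C(lift ord0 i, 2) * f (lift ord0 i) =
   \sum_(i < n.+1) (-1) ^+ i.+1 * qbin n i.+1 * q ^+ 'C(i.+1, 2) * f i.+1.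
  have z : qbin n n.+1 = 0 by rewrite /qbin ltnn.
  by rewrite big_ord_recr /= z mulr0 !mul0r addr0.
rewrite mulr_sumr -sumrB; apply: eq_bigr => i _ /=.
rewrite qbin_pascal /bump /= add1n.
have -> : q ^+ n = q ^+ (n - i) * q ^+ i.
  by rewrite -exprD subnK // -ltnS.
by rewrite binS bin1 exprD exprS; ring.
Qed.

Lemma eq_qdiff n f g : (forall k, f k = g k) -> qdiff n f = qdiff n g.
Proof. by move=> fg; apply: eq_bigr => k _; rewrite fg. Qed.

Lemma qdiffZ n c f : qdiff n (fun k => c * f k) = c * qdiff n f.
Proof. by rewrite /qdiff mulr_sumr; apply: eq_bigr => k _; ring. Qed.

Lemma qdiffD n f g : qdiff n (fun k => f k + g k) = qdiff n f + qdiff n g.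
Proof. by rewrite /qdiff -big_split; apply: eq_bigr => k _ /=; ring. Qed.

(** The q-binomial theorem: on powers of z the shift is multiplication by z, so [qdiffS] becomes the
    recurrence of (z; q)_n. *)
Lemma qdiff_exp n z : qdiff n (fun k => z ^+ k) = qpoch z q n.
Proof.
elim: n => [|n IH].
  by rewrite /qdiff big_ord1 qbin0 /qpoch big_ord0 !expr0 !mulr1.
rewrite qdiffS qpoch_recr -IH.
rewrite (@eq_qdiff n (_ \o succn) (fun k => z * z ^+ k)); last by move=> k /=; rewrite exprS.
by rewrite qdiffZ; ring.
Qed.

(** The induction varies a: shifting k replaces a by a q and brings out a factor q. The numerators
    then combine as (1 - a q^(n+1)) - q^(n+1) (1 - a) = 1 - q^(n+1). *)
Lemma qdiff_partial_fraction n a : 0 <= a -> a < 1 ->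
  qdiff n (fun k => q ^+ k / (1 - a * q ^+ k)) = qpoch q q n / qpoch a q n.+1.
Proof.
elim: n a => [|n IH] a a0 a1.
  rewrite /qdiff big_ord1 qbin0 /qpoch big_ord0 big_ord1 !expr0.
  by rewrite !mulr1 !mul1r.
have aq0 : 0 <= a * q by rewrite mulr_ge0 // ltW.
have aq1 : a * q < 1 by rewrite -[q]expr1 mulXn_lt1.
rewrite qdiffS IH //.
rewrite (@eq_qdiff n (_ \o succn) (fun k => q * (q ^+ k / (1 - a * q * q ^+ k)))); last first.
  by move=> k /=; rewrite exprS !mulrA.
rewrite qdiffZ IH // !(qpoch_recl a) (qpoch_recr (a * q)) (qpoch_recr q).
have := qpoch_gt0 n aq0 aq1; move/lt0r_neq0 => N.
have N1 : 1 - a != 0 by rewrite gt_eqF // subr_gt0.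
have N2 : 1 - a * q * q ^+ n != 0 by rewrite gt_eqF // subr_gt0 mulXn_lt1.
by field; rewrite N N1 N2.
Qed.

Lemma qpoch_expV_eq0 n m : (m < n)%N -> qpoch (q ^- m) q n = 0.
Proof.
move=> mn; rewrite /qpoch (bigD1 (Ordinal mn)) //= mulVf ?subrr ?mul0r //.
by rewrite expf_neq0 // gt_eqF.
Qed.

Lemma qpoch_expV n :
  qpoch (q ^- n) q n = (-1) ^+ n * q ^- 'C(n.+1, 2) * qpoch q q n.
Proof.
have qn0 : q != 0 by rewrite gt_eqF.
elim: n => [|n IH]; first by rewrite /qpoch !big_ord0 expr0 invr1 !mulr1.
rewrite qpoch_recl.
have -> : q ^- n.+1 * q = q ^- n by rewrite exprS; field; rewrite qn0 expf_neq0.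
rewrite IH qpoch_recr (binS n.+1) bin1 exprD !exprS.
by field; rewrite qn0 !expf_neq0.
Qed.

(** Since (q^-k)^m = (q^-m)^k, each monomial is a case of [qdiff_exp] with z = q^-m, and these
    values vanish for m < n. *)
Lemma qdiff_horner n (A : {poly R}) : (size A <= n.+1)%N ->
  qdiff n (fun k => A.[q ^- k]) = A`_n * qpoch (q ^- n) q n.
Proof.
move=> sA.
transitivity (\sum_(m < n.+1) A`_m * qdiff n (fun k => (q ^- m) ^+ k)).
  rewrite /qdiff; under [RHS]eq_bigr do rewrite mulr_sumr.
  rewrite exchange_big /=; apply: eq_bigr => k _.
  rewrite (horner_coef_wide _ sA) mulr_sumr; apply: eq_bigr => m _.
  by rewrite -!exprVn -!exprM mulnC; ring.
rewrite big_ord_recr /= qdiff_exp big1 ?add0r // => m _.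
by rewrite qdiff_exp qpoch_expV_eq0 ?mulr0.
Qed.

End QSums.

(** * Infinite q-Pochhammer symbols: convergence, positivity, monotonicity *)

Section QPochInf.
Variables (R : realType) (q : R).
Hypotheses (q0 : 0 < q) (q1 : q < 1).
Implicit Types (a b : R) (n k : nat).

Lemma mulXn_le1 a k : a <= 1 -> a * q ^+ k <= 1.
Proof.
move=> a1; have := exprn_ge0 k (ltW q0); have := exprn_ile1 k (ltW q0) (ltW q1).
by nra.
Qed.

Lemma qpoch_ge0 a n : a <= 1 -> 0 <= qpoch a q n.
Proof. by move=> a1; apply: prodr_ge0 => k _; rewrite subr_ge0 mulXn_le1. Qed.

Lemma qpoch_nonincreasing a : 0 <= a -> a <= 1 ->
  {homo qpoch a q : n m / (n <= m)%N >-> m <= n}.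
Proof.
move=> a0 a1; apply/nonincreasing_seqP => n; rewrite qpoch_recr.
by rewrite ler_piMr ?qpoch_ge0 // gerBl mulr_ge0 // exprn_ge0 // ltW.
Qed.

Lemma is_cvg_qpoch a : 0 <= a -> a <= 1 -> cvgn (qpoch a q).
Proof.
move=> a0 a1; apply: nonincreasing_is_cvgn; first exact: qpoch_nonincreasing.
by exists 0 => _ [n _ <-]; exact: qpoch_ge0.
Qed.

Lemma qpochInf_rec a : 0 <= a -> a <= 1 ->
  qpochInf a q = (1 - a) * qpochInf (a * q) q.
Proof.
move=> a0 a1.
have aq1 : a * q <= 1 by rewrite -[q]expr1 mulXn_le1.
have aq0 : 0 <= a * q by rewrite mulr_ge0 // ltW.
apply: cvg_lim => //; rewrite -cvg_shiftS /=.
under eq_fun do rewrite qpoch_recl.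
by apply: cvgM; [exact: cvg_cst | exact: is_cvg_qpoch].
Qed.

Lemma qpochInf_split a n : 0 <= a -> a <= 1 ->
  qpochInf a q = qpoch a q n * qpochInf (a * q ^+ n) q.
Proof.
move=> a0 a1; elim: n => [|n ->]; first by rewrite /qpoch big_ord0 mul1r mulr1.
rewrite (@qpochInf_rec (a * q ^+ n)) ?mulXn_le1 //.
  by rewrite qpoch_recr exprSr !mulrA.
by rewrite mulr_ge0 // exprn_ge0 // ltW.
Qed.

(** Weierstrass's inequality: the product of the 1 - a q^k is at least 1 minus the sum of the a q^k;
    both sides are multiplied by 1 - q. *)
Lemma qpoch_lower_bound a n : 0 <= a -> a <= 1 ->
  (1 - q) - a * (1 - q ^+ n) <= (1 - q) * qpoch a q n.
Proof.
move=> a0 a1; elim: n => [|n IH].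
  by rewrite /qpoch big_ord0 expr0 subrr mulr0 subr0 mulr1.
rewrite qpoch_recr exprS.
have P1 : qpoch a q n <= 1.
  have := @qpoch_nonincreasing a a0 a1 0%N n (leq0n n).
  by rewrite {2}/qpoch big_ord0.
have : 0 <= (1 - q) * (a * q ^+ n) * (1 - qpoch a q n).
  by rewrite !mulr_ge0 ?subr_ge0 ?exprn_ge0 // ltW.
by move: IH; lra.
Qed.

Lemma qpochInf_gt0 a : 0 <= a -> a < 1 -> 0 < qpochInf a q.
Proof.
move=> a0 a1.
have q1' : 0 < 1 - q by rewrite subr_gt0.
(* The lower bound gives a positive limit only for a parameter below 1 - q, so N factors are split
   off first to reach a q^N < 1 - q. *)
have /cvgrPdist_lt /(_ _ q1') [N _ /(_ N (leqnn N))] : (geometric a q @ \oo --> (0 : R))%classic.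
  by apply: cvg_geometric; rewrite gtr0_norm.
have aN0 : 0 <= a * q ^+ N by rewrite mulr_ge0 // exprn_ge0 // ltW.
rewrite /= sub0r normrN ger0_norm // => aN.
rewrite (@qpochInf_split a N) // ?ltW // mulr_gt0 // ?qpoch_gt0 //.
have aN1 : a * q ^+ N <= 1 by rewrite ltW // mulXn_lt1.
apply: (@lt_le_trans _ _ (1 - a * q ^+ N / (1 - q))).
  by rewrite subr_gt0 ltr_pdivrMr // mul1r.
apply: limr_ge; first exact: is_cvg_qpoch.
apply: nearW => n; rewrite -(ler_pM2l q1').
apply: le_trans (qpoch_lower_bound n aN0 aN1).
rewrite mulrBr mulr1 mulrCA divff ?mulr1 ?gt_eqF // lerD2l lerN2.
by rewrite ler_piMr // gerBl exprn_ge0 // ltW.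
Qed.

Lemma le_qpochInf a b : 0 <= a -> a <= b -> b <= 1 ->
  qpochInf b q <= qpochInf a q.
Proof.
move=> a0 ab b1; apply: ler_lim.
- by apply: is_cvg_qpoch => //; exact: le_trans ab.
- by apply: is_cvg_qpoch => //; exact: le_trans b1.
- apply: nearW => n; apply: ler_prod => k _.
  rewrite subr_ge0 mulXn_le1 //= lerD2l lerN2 ler_wpM2r //.
  by rewrite exprn_ge0 // ltW.
Qed.

(** Strictness comes from the first factors alone; the tails are compared weakly. The value b = 1
    must be allowed, for it occurs in [Delta] at n = 0. *)
Lemma lt_qpochInf a b : 0 <= a -> a < b -> b <= 1 ->
  qpochInf b q < qpochInf a q.
Proof.
move=> a0 ab b1; have b0 : 0 <= b by rewrite (le_trans a0) // ltW.
have a1 : a < 1 by exact: lt_le_trans b1.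
have aq0 : 0 <= a * q by rewrite mulr_ge0 // ltW.
have aq1 : a * q < 1 by rewrite -[q]expr1 mulXn_lt1.
rewrite (@qpochInf_rec b) // (@qpochInf_rec a) // ?ltW //.
apply: (@le_lt_trans _ _ ((1 - b) * qpochInf (a * q) q)).
  rewrite ler_wpM2l ?subr_ge0 // le_qpochInf //.
    by rewrite ler_wpM2r // ltW.
  by rewrite -[q]expr1 mulXn_le1.
by rewrite ltr_pM2r ?qpochInf_gt0 // ltrD2l ltrN2.
Qed.

End QPochInf.

(** * Stieltjes-Wigert weights, their moment sums and the removed mass *)

Section StieltjesWigert.
Variables (R : realType) (p q : R).
Hypotheses (q0 : 0 < q) (q1 : q < 1) (p0 : 0 <= p) (p1 : p < 1).
Implicit Types (n k i : nat) (r : R).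

Let qn0 : q != 0. Proof. by rewrite gt_eqF. Qed.
Let qXn0 k : q ^+ k != 0. Proof. by rewrite expf_neq0. Qed.
Let pqn0 k : 1 - p * q ^+ k != 0.
Proof. by rewrite gt_eqF // subr_gt0 mulXn_lt1. Qed.
Let qpoch_pn0 k : qpoch p q k != 0. Proof. by rewrite gt_eqF // qpoch_gt0. Qed.
Let qpoch_qn0 k : qpoch q q k != 0.
Proof. by rewrite gt_eqF // qpoch_gt0 // ltW. Qed.
Let powRqD (x y : R) : powR q (x + y) = powR q x * powR q y.
Proof. by rewrite powRD // qn0 implybT. Qed.

Lemma qpochD (a : R) i k :
  qpoch a q (k + i) = qpoch a q k * qpoch (a * q ^+ k) q i.
Proof.
rewrite /qpoch big_split_ord /=; congr (_ * _).
by apply: eq_bigr => j _; rewrite exprD mulrA.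
Qed.

Lemma natr_bin2 k : ('C(k.+1, 2))%:R = (k%:R + 1) * k%:R / 2 :> R.
Proof.
apply: (canRL (mulfK _)); rewrite ?pnatr_eq0 // natr1 -!natrM.
by rewrite mulnC -mul_bin_diag bin1.
Qed.

(** The roots are chosen so that the value at q^-k is q^-(k i) (p q^(k+1); q)_i. An extra factor X -
    c, with c = p or c = 1, will supply 1 - p q^k or 1 - q^k. *)
Definition node_poly i : {poly R} := \prod_(j < i) ('X - (p * q ^+ j.+1)%:P).

Lemma horner_node_poly (c : R) i k :
  (('X - c%:P) * node_poly i).[q ^- k]
  = q ^- (k * i.+1) * (1 - c * q ^+ k) * qpoch (p * q ^+ k.+1) q i.
Proof.
rewrite hornerM hornerXsubC mulnS exprD invfM.
have -> : (node_poly i).[q ^- k] = q ^- (k * i) * qpoch (p * q ^+ k.+1) q i.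
  elim: i => [|i IH].
    by rewrite /node_poly /qpoch !big_ord0 hornerC muln0 expr0 invr1 mulr1.
  rewrite /node_poly big_ord_recr hornerM -/(node_poly i) IH /= hornerXsubC.
  rewrite qpoch_recr mulnS exprD !exprS.
  by field; rewrite !qXn0.
by field; rewrite !qXn0.
Qed.

Lemma node_poly_monic (c : R) i : ('X - c%:P) * node_poly i \is monic.
Proof.
by rewrite monicMl ?monicXsubC // monic_prod_XsubC.
Qed.

Lemma size_node_poly (c : R) i : size (('X - c%:P) * node_poly i) = i.+2.
Proof.
rewrite size_monicM ?monicXsubC ?size_XsubC -?size_poly_eq0 ?size_prod_XsubC //.
by rewrite -[index_enum _]enumT size_enum_ord.
Qed.

(** The polynomial is monic of degree i + 1, at most n. The value is the same for every c, which
    lets the cases c = p and c = 1 combine. *)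
Lemma qdiff_node_poly (c : R) i n : (i < n)%N ->
  qdiff q n (fun k => (('X - c%:P) * node_poly i).[q ^- k])
  = if i.+1 == n then qpoch (q ^- n) q n else 0.
Proof.
move=> i_n; rewrite qdiff_horner ?size_node_poly //.
case: eqP => [<-|/eqP ni].
  have /monicP := node_poly_monic c i.
  by rewrite lead_coefE size_node_poly /= => ->; rewrite mul1r.
by rewrite nth_default ?mul0r // size_node_poly; lia.
Qed.

(* sw_coef without its factors depending on n alone. *)
Definition sw_weight n k : R :=
  (-1) ^+ k * qbinom q n k * powR q (k%:R ^+ 2 + k%:R / 2) / qpoch p q k.

(** The exponents match because -(k+i+1)^2/2 + k^2 + k/2 = -(i+1)^2/2 + k(k-1)/2 - k i, and (p;
    q)_(k+i) / (p; q)_k = (p q^k; q)_i. *)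
Lemma sw_mom_weight i n k : (k <= n)%N ->
  sw_mom p q (i + k) * sw_weight n k
  = powR q (- (i.+1%:R ^+ 2) / 2) *
    ((-1) ^+ k * qbin q n k * q ^+ 'C(k, 2)
     * (q ^- (k * i) * qpoch (p * q ^+ k) q i)).
Proof.
move=> kn; rewrite /sw_mom /sw_weight /qbin kn addnC qpochD.
have E : powR q (- ((k + i).+1%:R ^+ 2) / 2) * powR q (k%:R ^+ 2 + k%:R / 2) =
  powR q (- (i.+1%:R ^+ 2) / 2) * q ^+ 'C(k, 2) * q ^- (k * i).
  rewrite -!(powR_mulrn _ (ltW q0)) -powRN -!powRqD; congr powR.
  have C2 : ('C(k, 2))%:R = k%:R * (k%:R - 1) / 2 :> R.
    case: k {kn} => [|k]; first by rewrite mul0r mul0r.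
    by rewrite natr_bin2 -natr1; ring.
  by rewrite C2 -!natr1 natrD natrM; field.
set x := powR q _ in E *; set y := powR q _ in E *; set z := powR q _ in E *.
transitivity (qpoch (p * q ^+ k) q i * (-1) ^+ k * qbinom q n k * (x * y)).
  by field; rewrite qpoch_pn0.
by rewrite E; ring.
Qed.

(** The parameter r is left free so that one computation serves both sequences: r = 0 for the
    original moments, r = [mass_ratio n.+1] for the modified ones. *)
Definition sw_weight_tilde n r k : R :=
  sw_weight n k * (1 - (1 - q ^+ k) / (1 - p * q ^+ k) * r).

(** In rows of positive index the first factor of (p q^k; q)_(i+1) cancels the denominator 1 - p
    q^k. What remains is the node polynomial with c = p minus r times the one with c = 1. *)
Lemma sw_mom_weight_tilde_sum i n r : (i < n)%N ->
  \sum_(k < n.+1) sw_mom p q (i.+1 + k) * sw_weight_tilde n r k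
  = powR q (- (i.+2%:R ^+ 2) / 2) * (1 - r)
    * if i.+1 == n then qpoch (q ^- n) q n else 0.
Proof.
move=> i_n.
transitivity (powR q (- (i.+2%:R ^+ 2) / 2) * qdiff q n (fun k =>
    (('X - p%:P) * node_poly i).[q ^- k]
     + - r * (('X - 1%:P) * node_poly i).[q ^- k])).
  rewrite /qdiff mulr_sumr; apply: eq_bigr => k _.
  rewrite /sw_weight_tilde mulrA sw_mom_weight -1?ltnS //.
  rewrite !horner_node_poly qpoch_recl -(mulrA p) -exprSr.
  set z := q ^- _.
  by field; rewrite pqn0.
by rewrite qdiffD qdiffZ !qdiff_node_poly //; ring.
Qed.

(** Row 0 has no factor to cancel 1 - p q^k. Instead (1 - q^k)/(1 - p q^k) = 1 - (1 - p) q^k/(1 - p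
    q^k) leaves a constant and a partial fraction sum. *)
Lemma sw_mom_weight_tilde_sum0 n r :
  \sum_(k < n.+1) sw_mom p q k * sw_weight_tilde n r k
  = powR q (- (1 / 2)) * ((1 - r) * qpoch 1 q n
      + r * (qpoch q q n / qpoch (p * q) q n)).
Proof.
transitivity (powR q (- (1 / 2)) * qdiff q n (fun k =>
    (1 - r) * 1 ^+ k + r * (1 - p) * (q ^+ k / (1 - p * q ^+ k)))).
  rewrite /qdiff mulr_sumr; apply: eq_bigr => k _.
  have := @sw_mom_weight 0 n k (ltn_ord k).
  rewrite /sw_weight_tilde mulrA add0n => ->.
  rewrite muln0 expr0 invr1 /qpoch big_ord0 expr1n mulNr expr1n.
  by field; rewrite pqn0.
rewrite qdiffD !qdiffZ qdiff_exp // qdiff_partial_fraction // qpoch_recl.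
have := @qpoch_gt0 _ q q0 q1 (p * q) n.
have pq1 : p * q < 1 by rewrite -[q]expr1 mulXn_lt1.
rewrite mulr_ge0 ?(ltW q0) // => /(_ isT pq1)/lt0r_neq0 N.
have := pqn0 0; rewrite expr0 mulr1 => N1.
by field; rewrite N N1.
Qed.

(* q^(-1/2) * mass_ratio 1 is the mass removed at 0. *)
Definition mass_ratio n : R := qpochInf (q ^+ n) q / qpochInf (p * q ^+ n) q.

Lemma qpochInf_p_gt0 n : 0 < qpochInf (p * q ^+ n) q.
Proof.
by rewrite qpochInf_gt0 // ?mulXn_lt1 // mulr_ge0 // exprn_ge0 // ltW.
Qed.

Lemma qpochInf_p_rec n :
  qpochInf (p * q ^+ n) q = (1 - p * q ^+ n) * qpochInf (p * q ^+ n.+1) q.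
Proof.
rewrite qpochInf_rec //; first by rewrite exprSr mulrA.
  by rewrite mulr_ge0 // exprn_ge0 // ltW.
by rewrite ltW // mulXn_lt1.
Qed.

Lemma qpochInf_q_rec n :
  qpochInf (q ^+ n) q = (1 - q ^+ n) * qpochInf (q ^+ n.+1) q.
Proof.
rewrite qpochInf_rec //; first by rewrite exprSr.
  by rewrite exprn_ge0 // ltW.
by rewrite exprn_ile1 // ltW.
Qed.

Lemma mass_ratio_rec n :
  mass_ratio n = (1 - q ^+ n) / (1 - p * q ^+ n) * mass_ratio n.+1.
Proof.
rewrite /mass_ratio qpochInf_q_rec qpochInf_p_rec.
by field; rewrite pqn0 gt_eqF // qpochInf_p_gt0.
Qed.

Lemma mass_ratio0 : mass_ratio 0 = 0.
Proof. by rewrite mass_ratio_rec expr0 subrr !mul0r. Qed.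

(** This dictates the choice r = [mass_ratio n.+1]: it makes the partial fraction term of row 0
    equal to the removed mass, up to the common factor q^(-1/2). *)
Lemma mass_ratio1 n :
  mass_ratio 1 = qpoch q q n / qpoch (p * q) q n * mass_ratio n.+1.
Proof.
have pq1 : p * q < 1 by rewrite -[q]expr1 mulXn_lt1.
have pq0 : 0 <= p * q by rewrite mulr_ge0 // ltW.
rewrite /mass_ratio !expr1 (qpochInf_split q0 q1 n (ltW q0) (ltW q1)).
rewrite (qpochInf_split q0 q1 n pq0 (ltW pq1)) exprS mulrA.
have N : qpoch (p * q) q n != 0 by rewrite gt_eqF // qpoch_gt0.
have := qpochInf_p_gt0 n.+1; rewrite exprS mulrA => /lt0r_neq0 N'.
by field; rewrite N N'.
Qed.

Lemma Delta_mass_ratio n :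
  Delta p q n = qpochInf (p * q ^+ n) q * (1 - mass_ratio n).
Proof. by rewrite /Delta /mass_ratio; field; rewrite gt_eqF // qpochInf_p_gt0. Qed.

Lemma Delta_gt0 n : 0 < Delta p q n.
Proof.
rewrite subr_gt0 lt_qpochInf //.
- by rewrite mulr_ge0 // exprn_ge0 // ltW.
- by rewrite gtr_pMl // exprn_gt0.
- by rewrite exprn_ile1 // ltW.
Qed.

Lemma subr_mass_ratio_gt0 n : 0 < 1 - mass_ratio n.
Proof.
by have := Delta_gt0 n; rewrite Delta_mass_ratio pmulr_rgt0 // qpochInf_p_gt0.
Qed.

(** * The Hankel systems solved by the weights *)

Definition sw_pivot n : R :=
  powR q (- (n.+1%:R ^+ 2) / 2) * qpoch (q ^- n) q n.

Lemma sw_weight_tilde_r0 n k : sw_weight_tilde n 0 k = sw_weight n k.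
Proof. by rewrite /sw_weight_tilde mulr0 subr0 mulr1. Qed.

Lemma qpoch1E n : qpoch 1 q n = (n == 0%N)%:R.
Proof.
case: n => [|n]; first by rewrite /qpoch big_ord0.
by rewrite qpoch_recl subrr mul0r.
Qed.

Lemma sw_mom_system n i : (i <= n)%N ->
  \sum_(k < n.+1) sw_mom p q (i + k) * sw_weight n k
  = if i == n then sw_pivot n else 0.
Proof.
move=> i_n.
transitivity (\sum_(k < n.+1) sw_mom p q (i + k) * sw_weight_tilde n 0 k).
  by apply: eq_bigr => k _; rewrite sw_weight_tilde_r0.
case: i i_n => [|i] i_n.
  rewrite sw_mom_weight_tilde_sum0 mul0r addr0 subr0 mul1r qpoch1E.
  case: n i_n => [|n] _ /=; last by rewrite !mulr0.
  by rewrite /sw_pivot /qpoch big_ord0 expr1n mulNr !mul1r !mulr1.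
rewrite sw_mom_weight_tilde_sum // subr0 mulr1.
by case: eqP => [<-|_]; rewrite ?mulr0.
Qed.

Lemma sw_weight0 n : sw_weight n 0 = 1.
Proof.
have := qbin0 q0 q1 n; rewrite /qbin /= /sw_weight => ->.
by rewrite expr0n /= mul0r addr0 powRr0 /qpoch big_ord0 expr0 !mulr1 invr1 mulr1.
Qed.

(** Rows of positive index contain only unmodified moments. In row 0 the removed mass cancels the
    partial fraction term. *)
Lemma sw_mom_tilde_system n i : (i <= n)%N ->
  \sum_(k < n.+1) sw_mom_tilde p q (i + k)
     * sw_weight_tilde n (mass_ratio n.+1) k
  = if i == n then sw_pivot n * (1 - mass_ratio n.+1) else 0.
Proof.
case: i => [|i] i_n; last first.
  rewrite sw_mom_weight_tilde_sum //.
  by case: eqP => [<-|_]; rewrite ?mulr0 // /sw_pivot; ring.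
have E : sw_mom p q 0 = powR q (- (1 / 2)).
  by rewrite /sw_mom /qpoch big_ord0 expr1n mulNr !mul1r.
(* Only the term k = 0 sees the modified moment, and its weight is 1 because the bracket contains 1
   - q^0 = 0. *)
transitivity (\sum_(k < n.+1) sw_mom p q k * sw_weight_tilde n (mass_ratio n.+1) k
   - powR q (- (1 / 2)) * mass_ratio 1).
  rewrite !big_ord_recl /= /sw_weight_tilde sw_weight0 E expr0 subrr !mul0r.
  by rewrite subr0 !mulr1 /mass_ratio expr1; ring.
rewrite sw_mom_weight_tilde_sum0 (mass_ratio1 n) qpoch1E.
case: n i_n => [|n] _ /=; last by ring.
by rewrite /sw_pivot /qpoch !big_ord0 expr1n mulNr !mul1r !mulr1 invr1; ring.
Qed.

Lemma sw_weight_tilde_last n :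
  sw_weight_tilde n (mass_ratio n.+1) n = sw_weight n n * (1 - mass_ratio n).
Proof. by rewrite /sw_weight_tilde -mass_ratio_rec. Qed.

(** The two signs (-1)^n cancel, and the exponents of q add up to -(n + 1/2) = -2(n/2 + 1/4). The
    inverse square root of this value is the normalising factor in [sw_coef]. *)
Lemma sw_pivot_weight n :
  sw_pivot n * sw_weight n n
  = (powR q (n%:R / 2 + 1 / 4)) ^- 2 * (qpoch q q n / qpoch p q n).
Proof.
rewrite /sw_pivot qpoch_expV // /sw_weight /qbinom subnn {4}/qpoch big_ord0 mulr1.
rewrite divff // mulr1.
have E : powR q (- (n.+1%:R ^+ 2) / 2) * powR q (n%:R ^+ 2 + n%:R / 2)
   * q ^- 'C(n.+1, 2) = (powR q (n%:R / 2 + 1 / 4)) ^- 2.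
  rewrite [X in _ = X^-1]expr2 -!(powR_mulrn _ (ltW q0)) -!powRqD -!powRN -!powRqD; congr powR.
  by rewrite natr_bin2 -!natr1; field.
rewrite -E.
have S : (-1) ^+ n * (-1) ^+ n = 1 :> R by rewrite -expr2 sqrr_sign.
set x := powR q _; set y := powR q _; set z := q ^- _.
transitivity (((-1) ^+ n * (-1) ^+ n) * (x * y * z * (qpoch q q n / qpoch p q n))).
  by ring.
by rewrite S mul1r.
Qed.

Lemma sw_pivot_weight_gt0 n : 0 < sw_pivot n * sw_weight n n.
Proof.
rewrite sw_pivot_weight mulr_gt0 // ?divr_gt0 ?qpoch_gt0 // ?ltW //.
by rewrite invr_gt0 exprn_gt0 // powR_gt0.
Qed.

Lemma sgr_sw_pivot n : Num.sg (sw_pivot n) = (-1) ^+ n.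
Proof.
rewrite /sw_pivot qpoch_expV // !sgrM sgrX sgrN1 sgrV sgrX.
by rewrite !gtr0_sg ?qpoch_gt0 ?powR_gt0 ?(ltW q0) // expr1n !mulr1 mul1r.
Qed.

Lemma sw_pivot_weight_tilde n :
  sw_pivot n * (1 - mass_ratio n.+1) * sw_weight_tilde n (mass_ratio n.+1) n
  = sw_pivot n * sw_weight n n * ((1 - mass_ratio n) * (1 - mass_ratio n.+1)).
Proof. by rewrite sw_weight_tilde_last; ring. Qed.

Lemma sw_pivot_weight_tilde_gt0 n :
  0 < sw_pivot n * (1 - mass_ratio n.+1) * sw_weight_tilde n (mass_ratio n.+1) n.
Proof.
rewrite sw_pivot_weight_tilde; apply: mulr_gt0 (sw_pivot_weight_gt0 n) _.
by rewrite mulr_gt0 ?subr_mass_ratio_gt0.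
Qed.

(** * Determinants and orthonormal coefficients for the modified moments *)

Lemma hankel_tilde_gt0 n : 0 < hankel (sw_mom_tilde p q) n.
Proof.
(* Multiplying E_m v_m = h E_(m-1) by v_m gives E_m v_m^2 = (h v_m) E_(m-1), which is positive. *)
have step m : 0 < hankel_prev (sw_mom_tilde p q) m -> 0 < hankel (sw_mom_tilde p q) m.
  move=> Hm; have := hankel_system_step (@sw_mom_tilde_system m).
  have := sw_pivot_weight_tilde_gt0 m.
  set h := sw_pivot m * _; set v := sw_weight_tilde _ _ _ => hv E.
  have v0 : v != 0 by apply: contraTneq hv => ->; rewrite mulr0 ltxx.
  have v2 : 0 < v ^+ 2 by rewrite exprn_even_gt0.
  by rewrite -(pmulr_lgt0 _ v2) expr2 mulrA E mulrAC mulr_gt0.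
by elim: n => [|n IH]; apply: step.
Qed.

(** Comparing the relations E_m v_m = h E_(m-1) of both systems, the quotient of the two
    determinants gains the factor (1 - [mass_ratio m.+1]) / (1 - [mass_ratio m]). This telescopes
    from [mass_ratio0]. *)
Lemma hankel_tilde n :
  hankel (sw_mom_tilde p q) n = (1 - mass_ratio n.+1) * hankel (sw_mom p q) n.
Proof.
have step m : hankel_prev (sw_mom_tilde p q) m
      = (1 - mass_ratio m) * hankel_prev (sw_mom p q) m ->
    hankel (sw_mom_tilde p q) m = (1 - mass_ratio m.+1) * hankel (sw_mom p q) m.
  move=> Hm; have := hankel_system_step (@sw_mom_tilde_system m).
  have E' := hankel_system_step (@sw_mom_system m).
  rewrite Hm sw_weight_tilde_last => E.
  have w0 : sw_weight m m * (1 - mass_ratio m) != 0.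
    rewrite mulf_neq0 //; last by rewrite gt_eqF ?subr_mass_ratio_gt0.
    by apply: contraTneq (sw_pivot_weight_gt0 m) => ->; rewrite mulr0 ltxx.
  apply: (mulIf w0); rewrite E.
  transitivity ((1 - mass_ratio m.+1) * (1 - mass_ratio m)
     * (hankel (sw_mom p q) m * sw_weight m m)); last by ring.
  by rewrite E'; ring.
elim: n => [|n IH]; apply: step => //.
by rewrite mass_ratio0 subr0 mul1r.
Qed.

Lemma coef_orthonormal_tilde n k : (k <= n)%N ->
  (orthonormal_poly (sw_mom_tilde p q) n)`_k
  = (-1) ^+ n * powR q (n%:R / 2 + 1 / 4) * Num.sqrt (qpoch p q n / qpoch q q n)
    * (Num.sqrt ((1 - mass_ratio n) * (1 - mass_ratio n.+1)))^-1
    * sw_weight_tilde n (mass_ratio n.+1) k.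
Proof.
move=> kn.
have := coef_orthonormal_poly_system (@sw_mom_tilde_system n)
  (Ordinal (kn : (k < n.+1)%N)) (sw_pivot_weight_tilde_gt0 n).
move=> /= ->; last by case: n kn => // n _; exact: hankel_tilde_gt0.
rewrite sw_pivot_weight_tilde sw_pivot_weight sgrM sgr_sw_pivot gtr0_sg ?subr_mass_ratio_gt0 // mulr1.
have -> : qpoch p q n / qpoch q q n = (qpoch q q n / qpoch p q n)^-1.
  by rewrite invf_div.
set x := powR q _.
have x0 : 0 < x by rewrite powR_gt0.
have y0 : 0 < qpoch q q n / qpoch p q n by rewrite divr_gt0 ?qpoch_gt0 // ltW.
rewrite sqrtrM; last by rewrite mulr_ge0 ?invr_ge0 ?exprn_ge0 // ltW.
rewrite sqrtrM ?invr_ge0 ?exprn_ge0 ?(ltW x0) //.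
rewrite -exprVn sqrtr_sqr ger0_norm ?invr_ge0 ?(ltW x0) // sqrtrV ?(ltW y0) //.
field.
by rewrite !gt_eqF // sqrtr_gt0 // mulr_gt0 ?subr_mass_ratio_gt0.
Qed.

(** With X = (p q^(n+1); q)_oo, the product of the two [Delta] values is (1 - p q^n) X^2 times the
    product under the root on the left. *)
Lemma sqrt_mass_ratio n :
  (Num.sqrt ((1 - mass_ratio n) * (1 - mass_ratio n.+1)))^-1
  = Num.sqrt (1 - p * q ^+ n) * (qpochInf (p * q ^+ n.+1) q
     / Num.sqrt (Delta p q n * Delta p q n.+1)).
Proof.
rewrite !Delta_mass_ratio (qpochInf_p_rec n).
set X := qpochInf _ _; set P := 1 - p * _.
have X0 : 0 < X by exact: qpochInf_p_gt0.
have P0 : 0 < P by rewrite subr_gt0 mulXn_lt1.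
have N := subr_mass_ratio_gt0 n; have N' := subr_mass_ratio_gt0 n.+1.
have -> : P * X * (1 - mass_ratio n) * (X * (1 - mass_ratio n.+1)) =
   P * (X ^+ 2 * ((1 - mass_ratio n) * (1 - mass_ratio n.+1))) by ring.
rewrite (sqrtrM _ (ltW P0)) (sqrtrM _ (exprn_ge0 2 (ltW X0))).
rewrite sqrtr_sqr gtr0_norm //.
by field; rewrite !gt_eqF // sqrtr_gt0 // mulr_gt0.
Qed.

End StieltjesWigert.

Theorem theorem4 (R : realType) (p q : R) :
  0 < q -> q < 1 -> 0 <= p -> p < 1 ->
  let Ct := fun n : nat =>
    (-1) ^+ n * powR q (n%:R / 2 + 1 / 4) * Num.sqrt (qpoch p q n / qpoch q q n)
    * (Num.sqrt ((1 - qpochInf (q ^+ n) q / qpochInf (p * q ^+ n) q)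
                 * (1 - qpochInf (q ^+ n.+1) q / qpochInf (p * q ^+ n.+1) q)))^-1 in
  let bt := fun k n : nat => (orthonormal_poly (sw_mom_tilde p q) n)`_k in
  (forall n k : nat, (k <= n)%N ->
     bt k n = Ct n * (-1) ^+ k * qbinom q n k * powR q (k%:R ^+ 2 + k%:R / 2)
                   / qpoch p q k
                   * (1 - (1 - q ^+ k) / (1 - p * q ^+ k)
                          * (qpochInf (q ^+ n.+1) q / qpochInf (p * q ^+ n.+1) q)))
  /\ (forall n : nat,
     Ct n = (-1) ^+ n * powR q (n%:R / 2 + 1 / 4)
            * Num.sqrt (qpoch p q n.+1 / qpoch q q n)
            * (qpochInf (p * q ^+ n.+1) q
               / Num.sqrt (Delta p q n * Delta p q n.+1)))
  /\ (forall n k : nat, (k <= n)%N ->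
     bt k n = sw_coef p q k n
              * (qpochInf (p * q ^+ n.+1) q
                 - (1 - q ^+ k) / (1 - p * q ^+ k) * qpochInf (q ^+ n.+1) q)
              * Num.sqrt ((1 - p * q ^+ n) / (Delta p q n * Delta p q n.+1)))
  /\ (forall n : nat,
     hankel (sw_mom_tilde p q) n
       = Delta p q n.+1 / qpochInf (p * q ^+ n.+1) q * hankel (sw_mom p q) n).
Proof.
move=> q0 q1 p0 p1 Ct bt.
have CtE n : Ct n = (-1) ^+ n * powR q (n%:R / 2 + 1 / 4)
    * Num.sqrt (qpoch p q n / qpoch q q n)
    * (Num.sqrt ((1 - mass_ratio p q n) * (1 - mass_ratio p q n.+1)))^-1 by [].
have P0 n : 0 < 1 - p * q ^+ n by rewrite subr_gt0 mulXn_lt1.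
split; [|split; [|split]] => n.
- move=> k kn; rewrite /bt coef_orthonormal_tilde // -CtE.
  by rewrite /sw_weight_tilde /sw_weight /mass_ratio !mulrA.
- rewrite CtE sqrt_mass_ratio // qpoch_recr.
  (* The last factor 1 - p q^n of (p; q)_(n+1) is the one that [sqrt_mass_ratio] brings out. *)
  rewrite (mulrAC (qpoch p q n)) [in RHS]sqrtrM; first by rewrite !mulrA.
  by rewrite divr_ge0 // ltW // qpoch_gt0 // ltW.
- move=> k kn; rewrite /bt coef_orthonormal_tilde // sqrt_mass_ratio //.
  rewrite (sqrtrM _ (ltW (P0 n))) sqrtrV; last first.
    by rewrite ltW // mulr_gt0 ?Delta_gt0.
  rewrite /sw_weight_tilde /sw_weight /mass_ratio /sw_coef.
  have X0 := qpochInf_p_gt0 q0 q1 p0 p1 n.+1.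
  have S0 : Num.sqrt (Delta p q n * Delta p q n.+1) != 0.
    by rewrite gt_eqF // sqrtr_gt0 mulr_gt0 ?Delta_gt0.
  have K0 : qpoch p q k != 0 by rewrite gt_eqF // qpoch_gt0.
  by field; rewrite S0 K0 !gt_eqF.
- rewrite hankel_tilde // Delta_mass_ratio //; congr (_ * _).
  by rewrite mulrAC divff ?mul1r // gt_eqF // qpochInf_p_gt0.
Qed.
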